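(* Let $a,b\ge 1$, $P=[a]\times[b]$ and $n=a+b$. Then the piecewise-linear rowmotion map $\rho_{\mathcal P}:\mathcal O(P)\to\mathcal O(P)$ and the piecewise-linear promotion map $\pi_{\mathcal P}:\mathcal O(P)\to\mathcal O(P)$ both have order $n$: $\rho_{\mathcal P}^{\,n}$ and $\pi_{\mathcal P}^{\,n}$ are the identity map on $\mathcal O(P)$, and no smaller positive power of either map is the identity.
   Context: $[a]\times[b]=\{(i,j)\in\mathbb Z^2:1\le i\le a,\ 1\le j\le b\}$ with $(i,j)\le(i',j')$ iff $i\le i'$ and $j\le j'$. For a finite poset $P$, let $\widehat P=P\cup\{\hat0,\hat1\}$ with $\hat0<x<\hat1$ for all $x\in P$, and write $y\lessdot x$ ($x$ covers $y$) when $y<x$ and no $z$ satisfies $y<z<x$. The order polytope $\mathcal O(P)$ is the set of order-preserving maps $f:P\to[0,1]$ (i.e. $x\le y\Rightarrow f(x)\le f(y)$); each such $f$ is extended to $\hat f$ on $\widehat P$ by $\hat f(\hat0)=0$, $\hat f(\hat1)=1$. For $x\in P$ the piecewise-linear toggle $\tau_x:\mathcal O(P)\to\mathcal O(P)$ leaves $f(y)$ unchanged for $y\ne x$ and sets $(\tau_xf)(x)=\max\{\hat f(y):y\in\widehat P,\ y\lessdot x\}+\min\{\hat f(y):y\in\widehat P,\ y\gtrdot x\}-f(x)$. Piecewise-linear rowmotion is $\rho_{\mathcal P}=\tau_{x_1}\circ\tau_{x_2}\circ\cdots\circ\tau_{x_p}$ where $x_1,\dots,x_p$ is any linear extension of $P$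 (so elements are toggled from the top of $P$ to the bottom; the result does not depend on the linear extension). For $P=[a]\times[b]$, the $k$-th file ($1\le k\le n-1$) is $\{(i,j)\in P: j-i+a=k\}$; let $\tau^*_k$ be the composition of the (pairwise commuting) toggles $\tau_x$ over $x$ in the $k$-th file, and define piecewise-linear promotion $\pi_{\mathcal P}=\tau^*_{n-1}\circ\cdots\circ\tau^*_2\circ\tau^*_1$ (files toggled from $1$ to $n-1$). *)

(* Defs.v *)
From HB Require Import structures.
From mathcomp Require Import all_boot all_order all_algebra.
Set Implicit Arguments. Unset Strict Implicit. Unset Printing Implicit Defensive.
Import Order.TTheory GRing.Theory Num.Theory.
Local Open Scope ring_scope.

Section PLToggle.
Variables (R : realFieldType) (T : finType) (leP : rel T).

(* P^ = P u {0^, 1^}:  inl x = x in P,  inr false = 0^,  inr true = 1^ *)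
Definition hatT := (T + bool)%type.
Definition hat0 : hatT := inr false.
Definition hat1 : hatT := inr true.

Definition hle (u v : hatT) : bool :=
  match u, v with
  | inr false, _ => true
  | _, inr true => true
  | inl x, inl y => leP x y
  | _, _ => false
  end.
Definition hlt (u v : hatT) : bool := hle u v && (u != v).
Definition hcovers (y x : hatT) : bool :=
  hlt y x && ~~ [exists z, hlt y z && hlt z x].

Definition hatf (f : T -> R) (u : hatT) : R :=
  match u with inl x => f x | inr b => if b then 1 else 0 end.

Definition seqmax (s : seq R) : R := foldr Num.max (head 0 s) s.
Definition seqmin (s : seq R) : R := foldr Num.min (head 0 s) s.

Definition toggle (x : T) (f : T -> R) : T -> R :=
  fun y => if y == x then
     seqmax [seq hatf f u | u <- enum [pred u | hcovers u (inl x)]]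
   + seqmin [seq hatf f u | u <- enum [pred u | hcovers (inl x) u]]
   - f x
  else f y.

Definition in_order_polytope (f : T -> R) : Prop :=
  (forall x, 0 <= f x <= 1) /\ (forall x y, leP x y -> f x <= f y).
End PLToggle.

Unset Implicit Arguments.
(* ---------- The poset [a] x [b] (0-based: (i,j) stands for (i+1,j+1)) ---- *)
Definition grid (a b : nat) := ('I_a * 'I_b)%type.
Definition grid_le (a b : nat) : rel (grid a b) :=
  fun x y => ((x.1 <= y.1)%N && (x.2 <= y.2)%N).

(* a linear extension of [a] x [b] (lexicographic order) *)
Definition grid_ext (a b : nat) : seq (grid a b) :=
  [seq (i, j) | i <- enum 'I_a, j <- enum 'I_b].

Definition pl_rowmotion (R : realFieldType) (a b : nat) (f : grid a b -> R)
  : grid a b -> R :=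
  foldr (fun x g => toggle (grid_le a b) x g) f (grid_ext a b).

(* file index j - i + a (1-based), = j0 - i0 + a (0-based); in 1..a+b-1 *)
Definition file (a b : nat) (x : grid a b) : nat := (x.2 + a - x.1)%N.

(* tau*_k : composition of the (commuting) toggles of the k-th file *)
Definition toggle_file (R : realFieldType) (a b k : nat) (f : grid a b -> R)
  : grid a b -> R :=
  foldr (fun x g => toggle (grid_le a b) x g) f
        [seq x <- grid_ext a b | file a b x == k].

Definition pl_promotion (R : realFieldType) (a b : nat) (f : grid a b -> R)
  : grid a b -> R :=
  foldl (fun g k => toggle_file R a b k g) f (iota 1 (a + b - 1)).

(* Main.v *)
Require Import Defs.
From HB Require Import structures.
From mathcomp Require Import all_boot all_order all_algebra.
From mathcomp Require Import ring lra zify fraction mpoly.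
From Stdlib Require Import FunctionalExtensionality.
Set Implicit Arguments. Unset Strict Implicit. Unset Printing Implicit Defensive.
Import Order.TTheory GRing.Theory Num.Theory.
Local Open Scope ring_scope.

(** Piecewise-linear rowmotion is the tropicalization of birational rowmotion over a field,
    x_{t+1}(v) x_t(v) (sum_{w covers v} 1/x_{t+1}(w)) = sum_{v covers u} x_t(u).
    Following Grinberg and Roby, weight v by A_t(v) = x_t(v) / sum_{v covers u} x_t(u) or by
    V_t(v) = 1 / (x_t(v) sum_{w covers v} 1/x_t(w)); rowmotion says exactly that V_{t+1} = A_t.
    The sum over the descending lattice paths from (i,q) to (j,1) weighted by A_t equals the one
    from (i-1,q) to (j-1,1) weighted by V_t, so iterating slides these path sums along the edges
    of the rectangle until they become single labels.  This gives the reciprocity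
    x_{t+i+j-1}(i,j) x_t(p+1-i,q+1-j) = alpha beta for j = 1; the recurrence propagates it to all
    columns (this step subtracts, hence the field), and applying it twice gives the period p + q.

    Any finite family of elements of R is the image, under "maximal exponent of the numerator
    minus maximal exponent of the denominator", of elements of a field of rational functions
    that are quotients of sums of monomials; on such quotients this map turns +, * and inverse
    into max, + and opposite, so the period passes to the piecewise-linear map.

    Promotion and rowmotion see the same space-time labelling along different slices:
    P_t(i,j) = F_{t+j}(i,j).  Minimality is read off the orbit of the constant labelling 1, which
    rowmotion sends through the indicators of the rank filters. *)

(** * Birational rowmotion on a rectangle *)

(* [g i j] is the path sum from (i,j) down to (e,1) for the weights
   V(i,j) = 1 / (X i j * (1/X(i+1,j) + 1/X(i,j+1))); rows and columns are numbered from 1. *)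
Definition corner_eq (K : fieldType) (p q e : nat) (X g : nat -> nat -> K) :=
  [/\ forall j, g 0%N j = 0, forall i, g i 0%N = 0 &
   forall i j, (0 < i <= p)%N -> (0 < j <= q)%N ->
    g i j * X i j * ((X i.+1 j)^-1 + (X i j.+1)^-1) =
    g i.-1 j + g i j.-1 + ((i == e) && (j == 1%N))%:R].

Section Birational.
Variables (K : fieldType) (p q : nat) (alpha beta : K).
Hypotheses (p_gt0 : (0 < p)%N) (q_gt0 : (0 < q)%N).
Hypotheses (alpha0 : alpha != 0) (beta0 : beta != 0).

(* Missing neighbours carry the label 0, which contributes 0 both to a sum of lower labels and,
   since 0^-1 = 0, to a sum of inverses of upper labels; the bottom and the top of the extended
   poset are placed at (0,1) and (p+1,q). *)
Definition framed (X : nat -> nat -> K) :=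
  [/\ forall i j, (0 < i <= p)%N -> (0 < j <= q)%N -> X i j != 0,
      forall i, (0 < i)%N -> X i 0%N = 0 /\ X i.-1 q.+1 = 0,
      forall j, (j <= q)%N -> X 0%N j = if j == 1%N then alpha else 0 &
      forall j, (j <= q)%N -> X p.+1 j = if j == q then beta else 0].

(* [X i j * S i j] below is the A-weighted path sum to (e+1,1).  The identity [SB] says that [S]
   is also the antidiagonal sum over m < i of (1/X(m+1,l) + 1/X(m,l+1)) g(m,l), l = i+j-1-m, and the equality of
   the two expressions is what makes both the recursion and the boundary value come out. *)
Lemma conversion e (X g : nat -> nat -> K) : framed X -> (0 < e)%N ->
  corner_eq p q e X g ->
  exists k : nat -> nat -> K,
  [/\ forall j, k 0%N j = 0, forall i, k i 0%N = 0,
   forall i j, (0 < i <= p)%N -> (0 < j <= q)%N ->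
    k i j * ((X i.-1 j + X i j.-1) / X i j) =
    k i.-1 j + k i j.-1 + ((i == e.+1) && (j == 1%N))%:R &
   forall i, (0 < i < p)%N -> k i.+1 q = g i q].
Proof.
move=> [Xn0 Xout X0 Xp] e0 [g0 g'0 gE].
pose S := fix S i j := if i is m.+1 then
  S m j + (g m j.-1 + ((m == e) && (j == 1%N))%:R) / X m j else 0.
have SS m j : S m.+1 j = S m j + (g m j.-1 + ((m == e) && (j == 1%N))%:R) / X m j.
  by [].
have e0F : (0%N == e) = false by case: (e) e0.
have S1 j : S 1%N j = 0 by rewrite /= g0 e0F addr0 mul0r addr0.
have SB i j : (i <= p)%N -> (0 < j <= q)%N ->
   S i.+1 j = S i j.+1 + ((X i.+1 j)^-1 + (X i j.+1)^-1) * g i j.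
  move=> ip jq; elim: i ip => [|i IH] ip; first by rewrite S1 g0 mulr0 addr0.
  rewrite SS IH; last by apply: ltnW.
  have X1 : X i.+1 j != 0 by apply: Xn0.
  have /(_ ip jq) E := gE i.+1 j.
  have -> : g i.+1 j.-1 = g i.+1 j * X i.+1 j * ((X i.+2 j)^-1 + (X i.+1 j.+1)^-1)
     - g i j - ((i.+1 == e) && (j == 1%N))%:R by rewrite E /=; ring.
  have jF : (j.+1 == 1%N) = false by lia.
  rewrite (SS i j.+1) jF andbF addr0 [j.+1.-1]/=.
  move: (X i.+2 j)^-1 (X i.+1 j.+1)^-1 (X i j.+1)^-1 (_%:R) => u v w d.
  by field.
(* In column q+1 every summand of [S] is divided by a label 0, hence vanishes. [SB] in column q then
   expresses [S] by a single value of g, which gives the last clause. *)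
have Sq i : (0 < i <= p)%N -> S i q.+1 = 0.
  move=> ip; have {ip} : (i <= p)%N by case/andP: ip.
  elim: i => // i IH ip; rewrite SS IH 1?ltnW //.
  have [_ ] := Xout i.+1 isT; rewrite /= => ->.
  by rewrite invr0 mulr0 addr0.
exists (fun i j => X i j * S i j); split => [j|i|i j|i].
- by rewrite mulr0.
- by case: i => [|i]; rewrite ?mulr0 //; have [-> _] := Xout i.+1 isT; rewrite mul0r.
- case: i => // m mp jq.
  have X1 : X m.+1 j != 0 by apply: Xn0.
  rewrite [m.+1.-1]/=.
  have -> : X m.+1 j * S m.+1 j * ((X m j + X m.+1 j.-1) / X m.+1 j)
     = S m.+1 j * (X m j + X m.+1 j.-1) by field.
  (* The recursion splits into the two first differences of [S]: in the row index by definition, in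
     the column index by [SB]. The terms g m (j-1) cancel. *)
  have E1 : X m j * (S m.+1 j - S m j) = g m j.-1 + ((m == e) && (j == 1%N))%:R.
    case: m mp {X1} => [|m] mp; first by rewrite S1 /= g0 e0F subrr mulr0 addr0.
    have X1 : X m.+1 j != 0 by apply: Xn0 => //; lia.
    by rewrite SS; field.
  have E2 : X m.+1 j.-1 * (S m.+1 j - S m.+1 j.-1) = - g m j.-1.
    case: j jq {X1 E1} => // [[|j]] jq.
      by have [-> _] := Xout m.+1 isT; rewrite mul0r g'0 oppr0.
    rewrite [j.+2.-1]/= (SB m j.+1); [|lia..].
    have jF : (j.+2 == 1%N) = false by [].
    rewrite (SS m j.+2) jF andbF addr0 [j.+2.-1]/=.
    have X1 : X m.+1 j.+1 != 0 by apply: Xn0 => //; lia.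
    move: (X m j.+2)^-1 => u; field. done.
  rewrite eqSS.
  have -> : ((m == e) && (j == 1%N))%:R = X m j * (S m.+1 j - S m j)
     + X m.+1 j.-1 * (S m.+1 j - S m.+1 j.-1) by rewrite E1 E2; ring.
  ring.
- move=> ip; rewrite -/S SB; [|lia..].
  rewrite Sq; last lia.
  have [_ ] := Xout i.+1 isT; rewrite /= => ->.
  have X1 : X i.+1 q != 0 by apply: Xn0; lia.
  by rewrite invr0; field.
Qed.

(* Summation by parts against 1/X, which satisfies the recursion dual to that of g. *)
Lemma duality e (X g : nat -> nat -> K) : framed X -> (0 < e <= p)%N ->
  corner_eq p q e X g -> g p q * X e 1%N = beta.
Proof.
move=> [Xn0 Xout X0 Xp] ep [g0 g'0 gE].
pose rhs i j := (X i j)^-1 * ((i == e) && (j == 1%N))%:R.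
have E : \sum_(1 <= i < p.+1) \sum_(1 <= j < q.+1)
    (g i j * (X i.+1 j)^-1 - g i.-1 j * (X i j)^-1 +
     (g i j * (X i j.+1)^-1 - g i j.-1 * (X i j)^-1)) =
    \sum_(1 <= i < p.+1) \sum_(1 <= j < q.+1) rhs i j.
  rewrite big_nat_cond [RHS]big_nat_cond; apply: eq_bigr => i; rewrite andbT => hi.
  rewrite big_nat_cond [RHS]big_nat_cond; apply: eq_bigr => j; rewrite andbT => hj.
  have X1 : X i j != 0 by apply: Xn0.
  rewrite /rhs; have /(_ hi hj) := gE i j.
  move: (_%:R) => d E; have -> : d = g i j * X i j * ((X i.+1 j)^-1 + (X i j.+1)^-1)
     - g i.-1 j - g i j.-1 by rewrite E; ring.
  move: (X i.+1 j)^-1 (X i j.+1)^-1 => u v; by field.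
have Er : \sum_(1 <= i < p.+1) \sum_(1 <= j < q.+1) rhs i j = (X e 1%N)^-1.
  rewrite (bigD1_seq e) /=; [|by rewrite mem_index_iota|by rewrite iota_uniq].
  rewrite [X in _ + X]big1 ?addr0; last first.
    move=> i /negbTE ie; rewrite big1 // => j _; by rewrite /rhs ie mulr0.
  rewrite (bigD1_seq 1%N) /=; [|by rewrite mem_index_iota|by rewrite iota_uniq].
  rewrite big1 ?addr0 /rhs ?eqxx ?mulr1 // => j /negbTE je; by rewrite je andbF mulr0.
(* The sum telescopes in both directions. Only the step from (p,q) to the top survives, since the
   other outer labels are 0, with inverse 0. *)
have El : \sum_(1 <= i < p.+1) \sum_(1 <= j < q.+1)
    (g i j * (X i.+1 j)^-1 - g i.-1 j * (X i j)^-1 +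
     (g i j * (X i j.+1)^-1 - g i j.-1 * (X i j)^-1)) = g p q / beta.
  under eq_bigr => i _ do rewrite big_split /=.
  rewrite big_split /= exchange_big /= [X in _ + X]big_nat_cond.
  rewrite [X in _ + X]big1 ?addr0; last first.
    move=> i; rewrite andbT => hi.
    rewrite big_add1 /=.
    rewrite (@telescope_sumr_eq _ _ _ (fun j => g i j * (X i j.+1)^-1)) //.
    have [_ ] := Xout i.+1 isT; rewrite /= => ->.
    by rewrite invr0 mulr0 g'0 mul0r subr0.
  rewrite big_nat_cond.
  under eq_bigr => j do rewrite andbT.
  transitivity (\sum_(1 <= j < q.+1) g p j * (X p.+1 j)^-1).
    rewrite [RHS]big_nat_cond; apply: eq_big => // j; rewrite andbT => hj.
    rewrite big_add1 /=.
    rewrite (@telescope_sumr_eq _ _ _ (fun i => g i j * (X i.+1 j)^-1)) //.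
    by rewrite g0 mul0r subr0.
  rewrite big_nat_recr //= big_nat_cond big1 ?add0r.
    by rewrite Xp // eqxx.
  move=> j; rewrite andbT => hj; rewrite Xp; last lia.
  have -> : (j == q) = false by lia.
  by rewrite invr0 mulr0.
have X1 : X e 1%N != 0 by apply: Xn0; lia.
have : g p q / beta = (X e 1%N)^-1 by rewrite -El E Er.
move=> H; have -> : g p q = (X e 1%N)^-1 * beta by rewrite -H; field.
by field.
Qed.

(** * Sliding path sums, reciprocity and periodicity *)

Variable (x : nat -> nat -> nat -> K).
Hypothesis x_framed : forall t, framed (x t).
Hypothesis x_rec : forall t i j, (0 < i <= p)%N -> (0 < j <= q)%N ->
  x t.+1 i j * x t i j * ((x t.+1 i.+1 j)^-1 + (x t.+1 i j.+1)^-1) =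
  x t i.-1 j + x t i j.-1.

(** By the recurrence, x_t / alpha is itself the path sum to (1,1) for the V-weights at time t+1.
    Each use of [conversion] moves the endpoint one row on, and V_{t+1} = A_t turns its output into
    the input at the next time. *)
Lemma column1_solution t e : (e < p)%N -> exists2 g,
  corner_eq p q e.+1 (x (t + e.+1)%N) g &
  forall r, (e < r <= p)%N -> g r q = x t (r - e)%N q / alpha.
Proof.
elim: e => [|e IH] ep.
  (* The border is cut to 0: the label alpha at (0,1), divided by alpha, becomes the source term 1
     at (1,1). *)
  exists (fun i j => if (i == 0)%N || (j == 0)%N then 0 else x t i j / alpha).
    split => [j|i|i j hi hj] //=; first by rewrite orbT.
    have [Xn0 Xout X0 Xp] := x_framed t.
    case: i hi => // i hi; case: j hj => // j hj; rewrite orbF /=.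
    have X1 := Xn0 _ _ hi hj.
    have E : x t i.+1 j.+1 / alpha * x (t + 1)%N i.+1 j.+1 *
     ((x (t + 1)%N i.+2 j.+1)^-1 + (x (t + 1)%N i.+1 j.+2)^-1) =
      (x t i j.+1 + x t i.+1 j) / alpha.
      rewrite addn1; have /= <- := x_rec t hi hj; ring.
    rewrite {}E.
    case: i j {X1} hi hj => [|i] [|j] hi hj; rewrite /= ?orbF ?addr0 ?add0r ?X0 ?addr0 //=.
    - have [-> _] := Xout 1%N isT; rewrite addr0; by field.
    - by rewrite add0r.
    - by have [-> _] := Xout i.+2 isT; rewrite addr0.
    - by rewrite mulrDl.
  move=> r hr; rewrite subn0.
  have -> : (r == 0)%N = false by lia.
  by have -> : (q == 0)%N = false by lia.
have [g gE gq] := IH (ltnW ep).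
have [k [k0 k'0 kE kq]] := conversion (x_framed _) (ltn0Sn e) gE.
exists k.
  split => // i j hi hj; rewrite -kE //.
  have [Xn0 _ _ _] := x_framed (t + e.+1)%N.
  have X1 := Xn0 _ _ hi hj.
  rewrite (addnS t e.+1) -(x_rec _ hi hj); move: (_ + _ : K) => s; by field.
case=> // r hr; rewrite kq; last lia.
by rewrite gq ?subSS //; lia.
Qed.

(** The path sum at (p,q) is evaluated twice: by [duality], and as a shifted label of x_t. *)
Lemma reciprocity_column1 t i : (0 < i <= p)%N ->
  x (t + i)%N i 1%N * x t (p.+1 - i)%N q = alpha * beta.
Proof.
case: i => // i hi; have [g gE gq] := @column1_solution t i hi.
have <- := duality (x_framed _) hi gE.
by rewrite gq; [rewrite subSS; field | lia].
Qed.

(** Strong induction on the column: the recurrence at (i,j-1) and the one at its antipode involve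
    only known columns, up to one label each. Written with a quotient, the formula also covers the
    neighbours outside the rectangle that occur, where both sides are 0 or alpha. *)
Lemma reciprocity_inv t i j : (0 < i <= p)%N -> (0 < j <= q)%N ->
  x (t + (i + j).-1)%N i j = alpha * beta / x t (p.+1 - i)%N (q.+1 - j)%N.
Proof.
have Xn0 s u v : (0 < u <= p)%N -> (0 < v <= q)%N -> x s u v != 0.
  by have [H _ _ _] := x_framed s; apply: H.
have bot s i' : (0 < i' <= p)%N -> x s i' 0%N = 0.
  by move=> hi; have [_ /(_ i') H _ _] := x_framed s; case: H => //; lia.
have top s i' : (i' <= p)%N -> x s i' q.+1 = 0.
  by move=> hi; have [_ /(_ i'.+1 isT) H _ _] := x_framed s; case: H.
have left s j' : (j' <= q)%N -> x s 0%N j' = if j' == 1%N then alpha else 0.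
  by have [_ _ H _] := x_framed s; apply: H.
have right s j' : (j' <= q)%N -> x s p.+1 j' = if j' == q then beta else 0.
  by have [_ _ _ H] := x_framed s; apply: H.
have ab0 : alpha * beta != 0 by rewrite mulf_neq0.
move=> hi hj; elim/ltn_ind: j i t hi hj => -[//|[|j]] IH i t hi hj.
  rewrite addn1 /= subSS subn0 -(@reciprocity_column1 t i) //.
  by field; apply: Xn0; lia.
set c := alpha * beta in ab0 IH *.
have IH1 i' t' : (0 < i' <= p)%N ->
    x (t' + (i' + j))%N i' j.+1 = c / x t' (p.+1 - i')%N (q - j)%N.
  by move=> hi'; have := IH j.+1 (ltnSn _) i' t' hi'; rewrite addnS subSS; apply; lia.
have R1 := x_rec (t + (i + j))%N hi (_ : (0 < j.+1 <= q)%N).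
have R2 := @x_rec t (p.+1 - i)%N (q - j)%N.
have {}R1 := R1 ltac:(lia); have {}R2 := R2 ltac:(lia) ltac:(lia).
have EA : x (t + (i + j))%N.+1 i j.+1 = c / x t.+1 (p.+1 - i)%N (q - j)%N.
  by rewrite -IH1 ?addSn.
have EB : x (t + (i + j))%N.+1 i.+1 j.+1 = c / x t (p.+1 - i).-1%N (q - j)%N.
  have [ip|ip] := ltnP i p.
    have -> : (t + (i + j)).+1%N = (t + (i.+1 + j))%N by lia.
    by rewrite IH1; [congr (c / x t _ _); lia|lia].
  have -> : i = p by lia.
  rewrite right; last lia.
  rewrite subSnn /= left; last lia.
  have -> : (j.+1 == q) = false by lia.
  have -> : (q - j == 1)%N = false by lia.
  by rewrite invr0 mulr0.
have EC : x (t + (i + j))%N i.-1 j.+1 = c / x t.+1 (p.+1 - i).+1%N (q - j)%N.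
  have [ip|ip] := ltnP 1 i.
    have -> : (t + (i + j))%N = (t.+1 + (i.-1 + j))%N by lia.
    by rewrite IH1; [congr (c / x t.+1 _ _); lia|lia].
  have -> : i = 1%N by lia.
  rewrite left; last lia.
  rewrite subSS subn0 right; last lia.
  have [->|j0] := eqVneq j 0%N; first by rewrite subn0 !eqxx /c mulfK.
  have -> : (j.+1 == 1)%N = false by lia.
  have -> : (q - j == q)%N = false by lia.
  by rewrite invr0 mulr0.
have ED : x (t + (i + j))%N i j = c / x t.+1 (p.+1 - i)%N (q - j).+1%N.
  case: j IH hj IH1 {R1 R2 EA EB EC} => [|j] IH hj IH1.
    by rewrite bot // subn0 top ?invr0 ?mulr0 //; lia.
  have := IH j.+1 _ i t.+1 hi _; rewrite !addnS addSn subSS => ->; [|lia..].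
  by congr (c / x _ _ _); lia.
have -> : (t + (i + j.+2).-1)%N = (t + (i + j))%N.+1 by lia.
have -> : (q.+1 - j.+2)%N = (q - j).-1 by lia.
move: R1 R2; rewrite EA EB EC IH1 // ED.
set u := x t.+1 _ _; set v := x t _ _; set w := x _ i j.+2.
have u0 : u != 0 by apply: Xn0; lia.
have v0 : v != 0 by apply: Xn0; lia.
have w0 : w != 0 by apply: Xn0; lia.
set A := x t (p.+1 - i).-1 _; set B := x t _ (q - j).-1.
move: (x t.+1 _ _) (x t.+1 _ _) => C D.
have B0 : B != 0 by apply: Xn0; lia.
move=> R1 R2.
(* The first recurrence is multiplied by u v and the second inserted; cancelling A then gives B = c
   / w. *)
have E : c * (A + c / w) = c * (A + B).
  have -> : c * (A + c / w) = u * v * (c / u * (c / v) * ((c / A)^-1 + w^-1)).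
    by rewrite invf_div; field; rewrite ab0 u0 v0 w0.
  by rewrite R1 -R2; move: D^-1 C^-1 => d d'; ring.
have {E} -> : B = c / w by apply: (addrI A); apply: (mulfI ab0); rewrite E.
by field; rewrite ab0 w0.
Qed.

Theorem birational_periodicity t i j : (0 < i <= p)%N -> (0 < j <= q)%N ->
  x (t + (p + q))%N i j = x t i j.
Proof.
move=> hi hj.
have X1 : x t i j != 0 by have [H _ _ _] := x_framed t; apply: H.
(* The delays of (i,j) and of its antipode add up to p + q. *)
have -> : (t + (p + q) = t + ((p.+1 - i) + (q.+1 - j)).-1 + (i + j).-1)%N by lia.
rewrite !reciprocity_inv; [|lia..].
rewrite !subKn; [|lia..].
by field; rewrite X1 beta0.
Qed.
End Birational.

(** * Tropicalization *)

Section Extrema.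
Variable R : realFieldType.

Definition is_max (s : seq R) (m : R) := (m \in s) /\ {in s, forall z, z <= m}.

Lemma is_max_uniq s s' m m' : s =i s' -> is_max s m -> is_max s' m' -> m = m'.
Proof.
move=> ss [ms le_m] [ms' le_m']; apply/eqP.
by rewrite eq_le le_m ?ss // le_m' // -ss.
Qed.

Lemma is_max_cat s s' m m' : is_max s m -> is_max s' m' -> is_max (s ++ s') (Num.max m m').
Proof.
move=> [ms le_m] [ms' le_m']; split.
  by rewrite mem_cat maxEle; case: ifP; rewrite ?ms ?ms' ?orbT.
move=> z; rewrite mem_cat le_max => /orP[/le_m-> //|/le_m'->]; exact: orbT.
Qed.

Lemma is_max_allpairs s s' m m' : is_max s m -> is_max s' m' ->
  is_max [seq x + y | x <- s, y <- s'] (m + m').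
Proof.
move=> [ms le_m] [ms' le_m']; split; first by apply/allpairsP; exists (m, m').
by move=> z /allpairsP[[x y] /= [/le_m xm /le_m' ym ->]]; apply: lerD.
Qed.

(** [seqmax] folds from the head, which thus enters twice and differs on the two sides; idempotence
    of max absorbs this. *)
Lemma seqmax_cons2 (x y : R) s : seqmax [:: x, y & s] = Num.max x (seqmax (y :: s)).
Proof.
rewrite /seqmax /=; have H z w : Num.max z (foldr Num.max w s) = Num.max w (foldr Num.max z s).
  by elim: s => [|a s IH] /=; [exact: maxC|rewrite maxCA IH maxCA].
have H' z : Num.max z (foldr Num.max z s) = foldr Num.max z s.
  by elim: s {H} => [|a s IH] /=; [exact: maxxx|rewrite maxCA IH].
by rewrite H maxA maxxx H'.
Qed.

Lemma seqmin_opp (s : seq R) : seqmin s = - seqmax [seq - x | x <- s].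
Proof.
rewrite /seqmin /seqmax; case: s => [|y s] /=; first by rewrite oppr0.
have H z : foldr Num.min z s = - foldr Num.max (- z) [seq - x | x <- s].
  by elim: s => [|a s IH] /=; rewrite ?opprK // oppr_max opprK IH.
by rewrite oppr_max opprK H.
Qed.
End Extrema.

(** The graph of a partial map: only subtraction-free elements need a value, and there is no rule
    for differences. *)
Record tropicalization (R : realFieldType) (K : fieldType) (V : K -> R -> Prop) : Prop :=
  Tropicalization {
    trop_inj : forall x u v, V x u -> V x v -> u = v;
    trop_neq0 : forall x u, V x u -> x != 0;
    trop_one : V 1 0;
    trop_add : forall x y u v, V x u -> V y v -> V (x + y) (Num.max u v);
    trop_mul : forall x y u v, V x u -> V y v -> V (x * y) (u + v);
    trop_inv : forall x u, V x u -> V x^-1 (- u) }.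

(** * Tropical values of quotients of sums of monomials *)

Section Existence.
Variables (R : realFieldType) (n : nat) (r : 'I_n -> R).
Variables (K : fieldType) (iota : {rmorphism {mpoly int[n]} -> K}).
Hypothesis iota_inj : injective iota.

(* Polynomials with natural coefficients are kept as sequences of monomials with repetition, so
   that sums and products never cancel and the maximal weight is exact. *)
Let weight (m : 'X_{1..n}) : R := \sum_i (m i)%:R * r i.
Let mpol (s : seq 'X_{1..n}) : {mpoly int[n]} := \sum_(m <- s) 'X_[m].
Let has_trop s := is_max [seq weight m | m <- s].
Let lifts (x : K) (v : R) := exists s s' c c',
  [/\ has_trop s c, has_trop s' c', x = iota (mpol s) / iota (mpol s') & v = c - c'].

Let coeff_mpol s m : (mpol s)@_m = (count_mem m s)%:R.
Proof.
rewrite /mpol raddf_sum /= -sum1_count natr_sum [RHS]big_mkcond /=.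
by apply: eq_bigr => i _; rewrite mcoeffX; case: eqP.
Qed.

Let mpol_neq0 s c : has_trop s c -> mpol s != 0.
Proof.
case=> /mapP[m ms _] _; apply/eqP => E.
have := coeff_mpol s m; rewrite E mcoeff0 => /esym/eqP.
by rewrite pnatr_eq0 -leqn0 leqNgt -has_count has_pred1 ms.
Qed.

Let mpol_mul s s' : mpol s * mpol s' = mpol [seq (m + m')%MM | m <- s, m' <- s'].
Proof.
rewrite /mpol big_allpairs_dep /= mulr_suml; apply: eq_bigr => m _.
by rewrite mulr_sumr; apply: eq_bigr => m' _; rewrite mpolyXD.
Qed.

Let weightD m m' : weight (m + m')%MM = weight m + weight m'.
Proof. by rewrite /weight -big_split; apply: eq_bigr => i _ /=; rewrite mnmDE natrD mulrDl. Qed.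

Let has_tropM s s' c c' : has_trop s c -> has_trop s' c' ->
  has_trop [seq (m + m')%MM | m <- s, m' <- s'] (c + c').
Proof.
move=> hs hs'; have := is_max_allpairs hs hs'.
rewrite /has_trop allpairs_mapl allpairs_mapr map_allpairs.
by rewrite (eq_allpairs _ _ weightD).
Qed.

Let has_tropD s s' c c' : has_trop s c -> has_trop s' c' ->
  has_trop (s ++ s') (Num.max c c').
Proof. by move=> hs hs'; rewrite /has_trop map_cat; apply: is_max_cat. Qed.

(** Coefficients are multiplicities, so equal polynomials contain the same monomials and hence the
    same weights. *)
Let mpol_inj s s' c c' : has_trop s c -> has_trop s' c' -> mpol s = mpol s' -> c = c'.
Proof.
move=> hs hs' E; apply: is_max_uniq hs hs'; apply: eq_mem_map => m.
have /eqP := congr1 (mcoeff m) E; rewrite !coeff_mpol eqr_nat => /eqP E'.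
by rewrite -!has_pred1 !has_count E'.
Qed.

Let tropicalization_lifts : tropicalization lifts.
Proof.
have ne s c : has_trop s c -> iota (mpol s) != 0 :> K.
  by move=> /mpol_neq0; rewrite -(rmorph0 iota) (inj_eq iota_inj).
split.
- move=> x _ _ [s1 [s2 [c1 [c2 [h1 h2 -> ->]]]]] [s3 [s4 [c3 [c4 [h3 h4 E ->]]]]].
  have /eqP := E; rewrite eqr_div ?(ne _ _ h2) ?(ne _ _ h4) //.
  rewrite -!rmorphM (inj_eq iota_inj) !mpol_mul => /eqP E'.
  have := mpol_inj (has_tropM h1 h4) (has_tropM h3 h2) E'; lra.
- move=> x u [s1 [s2 [c1 [c2 [h1 h2 -> _]]]]].
  by rewrite mulf_neq0 ?invr_neq0 ?(ne _ _ h1) ?(ne _ _ h2).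
- have h : has_trop [:: 0%MM] 0.
    have w0 : weight 0%MM = 0 by rewrite /weight big1 // => i _; rewrite mnm0E mul0r.
    by split=> [|z]; rewrite /= w0 ?inE // => /eqP ->.
  exists [:: 0%MM], [:: 0%MM], 0, 0; split=> //; last by rewrite subr0.
  by rewrite divff ?(ne _ _ h).
- move=> _ _ _ _ [s1 [s2 [c1 [c2 [h1 h2 -> ->]]]]] [s3 [s4 [c3 [c4 [h3 h4 -> ->]]]]].
  exists ([seq (m + m')%MM | m <- s1, m' <- s4] ++ [seq (m + m')%MM | m <- s3, m' <- s2]).
  exists [seq (m + m')%MM | m <- s2, m' <- s4].
  exists (Num.max (c1 + c4) (c3 + c2)), (c2 + c4); split.
  + by apply: has_tropD; apply: has_tropM.
  + exact: has_tropM.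
  + rewrite addf_div ?(ne _ _ h2) ?(ne _ _ h4) //.
    by rewrite -!rmorphM -rmorphD !mpol_mul /mpol big_cat.
  + rewrite -[RHS]/(_ - _) addr_maxl; congr (Num.max _ _); ring.
- move=> _ _ _ _ [s1 [s2 [c1 [c2 [h1 h2 -> ->]]]]] [s3 [s4 [c3 [c4 [h3 h4 -> ->]]]]].
  exists [seq (m + m')%MM | m <- s1, m' <- s3], [seq (m + m')%MM | m <- s2, m' <- s4].
  exists (c1 + c3), (c2 + c4); split; [exact: has_tropM|exact: has_tropM| |ring].
  by rewrite mulf_div -!rmorphM !mpol_mul.
- move=> _ _ [s1 [s2 [c1 [c2 [h1 h2 -> ->]]]]].
  by exists s2, s1, c2, c1; rewrite invf_div opprB.
Qed.

Let lifts_var i : lifts (iota 'X_i) (r i).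
Proof.
have h : has_trop [:: 0%MM] 0.
  have w0 : weight 0%MM = 0 by rewrite /weight big1 // => j _; rewrite mnm0E mul0r.
  by split=> [|z]; rewrite /= w0 ?inE // => /eqP ->.
have h' : has_trop [:: U_(i)%MM] (r i).
  have w0 : weight U_(i)%MM = r i.
    rewrite /weight (bigD1 i) //= big1 => [|j /negbTE ji].
      by rewrite mnm1E eqxx mul1r addr0.
    by rewrite mnm1E eq_sym ji mul0r.
  by split=> [|z]; rewrite /= w0 ?inE // => /eqP ->.
exists [:: U_(i)%MM], [:: 0%MM], (r i), 0; split => //; last by rewrite subr0.
by rewrite /mpol !big_seq1 mpolyX0 rmorph1 divr1.
Qed.
Lemma tropicalization_var :
  exists V : K -> R -> Prop, tropicalization V /\ forall i, V (iota 'X_i) (r i).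
Proof. by exists lifts; split; [exact: tropicalization_lifts|exact: lifts_var]. Qed.
End Existence.

Lemma tropicalization_exists (R : realFieldType) (T : finType) (r : T -> R) :
  exists (K : fieldType) (V : K -> R -> Prop),
  tropicalization V /\ exists x : T -> K, forall t, V (x t) (r t).
Proof.
pose iota : {rmorphism {mpoly int[#|T|]} -> {fraction {mpoly int[#|T|]}}} := @tofrac _.
have iota_inj : injective iota.
  by move=> x y /eqP; rewrite tofrac_eq => /eqP.
have [V [VT VX]] := tropicalization_var (fun i => r (enum_val i)) iota_inj.
exists {fraction {mpoly int[#|T|]}}, V; split=> //.
by exists (fun t => iota 'X_(enum_rank t)) => t; have := VX (enum_rank t); rewrite enum_rankK.
Qed.

Lemma trop_sum (R : realFieldType) (K : fieldType) (V : K -> R -> Prop) (U : eqType)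
    (F : U -> K) (f : U -> R) (s : seq U) : tropicalization V ->
  {in s, forall u, V (F u) (f u)} -> (0 < size s)%N ->
  V (\sum_(u <- s) F u) (seqmax [seq f u | u <- s]).
Proof.
move=> VT; case: s => // u s Ff _; elim: s u Ff => [|w s IH] u Ff.
  by rewrite big_seq1 /seqmax /= maxxx; apply/Ff/mem_head.
rewrite big_cons /= seqmax_cons2; apply: (trop_add VT); first exact/Ff/mem_head.
by apply: IH => v vs; apply: Ff; rewrite inE vs orbT.
Qed.

Lemma trop_harmonic (R : realFieldType) (K : fieldType) (V : K -> R -> Prop) (U : eqType)
    (F : U -> K) (f : U -> R) (s : seq U) : tropicalization V ->
  {in s, forall u, V (F u) (f u)} -> (0 < size s)%N ->
  V (\sum_(u <- s) (F u)^-1)^-1 (seqmin [seq f u | u <- s]).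
Proof.
move=> VT Ff s0; rewrite seqmin_opp -map_comp.
by apply: (trop_inv VT); apply: trop_sum => // u us; apply/(trop_inv VT)/Ff.
Qed.

(** * Sweeping the rectangle *)

Section Sweep.
Variables (T : eqType) (S : Type) (upd : (T -> S) -> T -> S).

(** A composition of toggles with an arbitrary update rule, shared by the piecewise-linear and the
    birational maps. *)
Definition sweep (s : seq T) (f : T -> S) : T -> S :=
  foldr (fun x g y => if y == x then upd g x else g y) f s.

Lemma sweep_notin s f y : y \notin s -> sweep s f y = f y.
Proof.
elim: s => //= z s IH; rewrite inE negb_or => /andP[/negbTE -> ys]; exact: IH.
Qed.

(** Here h is the labelling at the moment x is updated. [foldr] works from the right end, so smaller
    keys still carry old labels and larger keys final ones. *)
Lemma sweepP (key : T -> nat) s f x :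
  uniq s -> pairwise (fun y z => key y <= key z)%N s -> x \in s ->
  exists h, [/\ sweep s f x = upd h x, h x = f x,
    forall y, (key y < key x)%N -> h y = f y &
    forall y, y \in s -> (key x < key y)%N -> h y = sweep s f y].
Proof.
elim: s => //= z s IH /andP[zs us] /andP[/allP zk ps]; rewrite inE => /predU1P[->|xs].
  exists (sweep s f); split; first by rewrite eqxx.
  - exact: sweep_notin.
  - by move=> y yz; apply: sweep_notin; apply/negP => /zk; lia.
  - by move=> y ys; case: eqVneq => [->|//]; rewrite ltnn.
have [h [hx hf hlt hgt]] := IH us ps xs.
exists h; split => //.
  by case: eqVneq => // xz; rewrite -xz xs in zs.
move=> y; rewrite inE; case: eqVneq => [-> _|_ /= ys]; last exact: hgt.
by have := zk _ xs; lia.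
Qed.
End Sweep.

(** * Covers in the rectangle with bottom and top adjoined *)

Section Grid.
Variables (a b : nat).
Hypotheses (a_gt0 : (0 < a)%N) (b_gt0 : (0 < b)%N).
Local Notation grid := (grid a b).
Local Notation hat := (hatT grid).

Definition below (x : grid) : seq hat :=
  enum [pred u | hcovers (grid_le a b) u (inl x)].
Definition above (x : grid) : seq hat :=
  enum [pred u | hcovers (grid_le a b) (inl x) u].

(* The placement used by [framed]: with it, both kinds of covers become unit steps. *)
Definition pos (u : hat) : nat * nat :=
  match u with
  | inl x => (x.1.+1, x.2.+1)%N
  | inr c => if c then (a.+1, b) else (0%N, 1%N)
  end.

Lemma pos_inj : injective pos.
Proof.
move=> [[[i hi] [j hj]]|[]] [[[i' hi'] [j' hj']]|[]] //= []; try lia.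
by move=> ei ej; congr (inl (_, _)); apply: val_inj.
Qed.

Lemma hcovers_inl (x y : grid) : hcovers (grid_le a b) (inl y) (inl x) =
  (y.1.+1 == x.1 :> nat) && (y.2 == x.2 :> nat) ||
  (y.1 == x.1 :> nat) && (y.2.+1 == x.2 :> nat).
Proof.
have neE (u v : grid) : (inl u != inl v :> hat) =
    ~~ ((u.1 == v.1 :> nat) && (u.2 == v.2 :> nat)).
  by case: u v => [u1 u2] [v1 v2].
rewrite /hcovers /hlt /= neE /grid_le.
case: x y => [[i hi] [j hj]] [[i' hi'] [j' hj']] /=.
apply/idP/idP => [/andP[lt /existsPn no]|H].
  (* The neighbour just below x, in a direction where y is smaller, lies weakly above y; since
     nothing lies strictly between, it is y. *)
  have [hii|hii] := ltnP i' i.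
    have hi1 : (i.-1 < a)%N by lia.
    by have := no (inl (Ordinal hi1, Ordinal hj)); rewrite !neE /=; lia.
  have hj1 : (j.-1 < b)%N by lia.
  by have := no (inl (Ordinal hi, Ordinal hj1)); rewrite !neE /=; lia.
apply/andP; split; first by lia.
apply/existsPn => -[[[k hk] [l hl]]|[]] //; rewrite !neE /=; lia.
Qed.

Lemma hcovers_below (x : grid) u : hcovers (grid_le a b) u (inl x) =
  (pos u == (x.1 : nat, x.2.+1)) || (pos u == (x.1.+1, x.2 : nat)).
Proof.
case: u => [y|[]]; first by rewrite hcovers_inl /= !xpair_eqE !eqSS.
  by case: x => [[i hi] [j hj]]; rewrite /hcovers /hlt /= !xpair_eqE; lia.
case: x => [[i hi] [j hj]]; rewrite /hcovers /hlt /= !xpair_eqE.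
apply/idP/idP => [/existsPn no|H].
  have /= := no (inl (Ordinal a_gt0, Ordinal b_gt0)).
  have -> : (inl (Ordinal a_gt0, Ordinal b_gt0) != inl (Ordinal hi, Ordinal hj) :> hat)
     = ~~ ((0%N == i) && (0%N == j)) by [].
  rewrite /grid_le /=; lia.
apply/existsPn => -[[[k hk] [l hl]]|[]] //.
have -> : (inl (Ordinal hk, Ordinal hl) != inl (Ordinal hi, Ordinal hj) :> hat)
     = ~~ ((k == i) && (l == j)) by [].
rewrite /grid_le /=; lia.
Qed.

Lemma hcovers_above (x : grid) u : hcovers (grid_le a b) (inl x) u =
  (pos u == (x.1.+2, x.2.+1)) || (pos u == (x.1.+1, x.2.+2)).
Proof.
case: u => [y|[]]; first by rewrite hcovers_inl /= !xpair_eqE !eqSS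
   ![(y.1 : nat) == _]eq_sym ![(y.2 : nat) == _]eq_sym.
  case: x => [[i hi] [j hj]]; rewrite /hcovers /hlt /= !xpair_eqE.
  apply/idP/idP => [/existsPn no|H].
    have a1 : (a.-1 < a)%N by lia.
    have b1 : (b.-1 < b)%N by lia.
    have /= := no (inl (Ordinal a1, Ordinal b1)).
    have -> : (inl (Ordinal hi, Ordinal hj) != inl (Ordinal a1, Ordinal b1) :> hat)
       = ~~ ((i == a.-1) && (j == b.-1)) by [].
    rewrite /grid_le /=; lia.
  apply/existsPn => -[[[k hk] [l hl]]|[]] //.
  have -> : (inl (Ordinal hi, Ordinal hj) != inl (Ordinal hk, Ordinal hl) :> hat)
     = ~~ ((i == k) && (j == l)) by [].
  rewrite /grid_le /=; lia.
by case: x => [[i hi] [j hj]]; rewrite /hcovers /hlt /= !xpair_eqE; lia.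
Qed.

Lemma mem_below x u : (u \in below x) =
  (pos u == (x.1 : nat, x.2.+1)) || (pos u == (x.1.+1, x.2 : nat)).
Proof. by rewrite mem_enum inE hcovers_below. Qed.

Lemma mem_above x u : (u \in above x) =
  (pos u == (x.1.+2, x.2.+1)) || (pos u == (x.1.+1, x.2.+2)).
Proof. by rewrite mem_enum inE hcovers_above. Qed.

Lemma below_neq0 x : (0 < size (below x))%N.
Proof.
suff [u ux] : exists u, u \in below x by case: (below x) ux.
case: x => [[i hi] [j hj]].
have [i0|i0] := posnP i; last first.
  have hi1 : (i.-1 < a)%N by lia.
  by exists (inl (Ordinal hi1, Ordinal hj)); rewrite mem_below /= !xpair_eqE /=; lia.
have [j0|j0] := posnP j.
  by exists (inr false); rewrite mem_below /= !xpair_eqE; lia.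
have hj1 : (j.-1 < b)%N by lia.
by exists (inl (Ordinal a_gt0, Ordinal hj1)); rewrite mem_below /= !xpair_eqE /=; lia.
Qed.

Lemma above_neq0 x : (0 < size (above x))%N.
Proof.
suff [u ux] : exists u, u \in above x by case: (above x) ux.
case: x => [[i hi] [j hj]].
have [hi1|ia] := ltnP i.+1 a.
  by exists (inl (Ordinal hi1, Ordinal hj)); rewrite mem_above /= !xpair_eqE /=; lia.
have [hj1|jb] := ltnP j.+1 b.
  by exists (inl (Ordinal hi, Ordinal hj1)); rewrite mem_above /= !xpair_eqE /=; lia.
by exists (inr true); rewrite mem_above /= !xpair_eqE; lia.
Qed.

(** Generalizes [hatf]: the lifted labelling has 1 and beta at the bottom and the top, with tropical
    values 0 and 1. *)
Definition hatv (S : Type) (c0 c1 : S) (f : grid -> S) (u : hat) : S :=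
  match u with inl x => f x | inr c => if c then c1 else c0 end.

Lemma pairwise_grid_ext :
  pairwise (fun y z : grid => y.1 * b + y.2 <= z.1 * b + z.2)%N (grid_ext a b).
Proof.
have pe n : pairwise (fun i j : 'I_n => i < j)%N (enum 'I_n).
  rewrite -(pairwise_map (@nat_of_ord n) ltn) val_enum_ord.
  by rewrite -sorted_pairwise; [exact: iota_ltn_sorted|exact: ltn_trans].
rewrite /grid_ext; elim: (enum 'I_a) (pe a) => //= i r IH /andP[/allP ir pr].
rewrite pairwise_cat IH // andbT; apply/andP; split.
  apply/allrelP => _ _ /mapP[j _ ->] /allpairsP[[i' j'] /= [/ir ii' _ ->]] /=.
  by case: j => j hj /=; nia.
rewrite pairwise_map; apply: sub_pairwise (pe b) => j j' /=; lia.
Qed.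

Lemma mem_grid_ext x : x \in grid_ext a b.
Proof. by case: x => i j; apply/allpairsP; exists (i, j); rewrite !mem_enum. Qed.

Lemma uniq_grid_ext : uniq (grid_ext a b).
Proof. by apply: allpairs_uniq; rewrite ?enum_uniq // => -[? ?] [? ?]. Qed.

Lemma sweep_grid_ext (S : Type) (upd : (grid -> S) -> grid -> S) f x :
  exists h, [/\ sweep upd (grid_ext a b) f x = upd h x, h x = f x,
    forall c0 c1, {in below x, hatv c0 c1 h =1 hatv c0 c1 f} &
    forall c0 c1, {in above x, hatv c0 c1 h =1 hatv c0 c1 (sweep upd (grid_ext a b) f)}].
Proof.
have [h [hx hf hlt hgt]] := sweepP upd f uniq_grid_ext pairwise_grid_ext (mem_grid_ext x).
exists h; split=> // c0 c1 [y|//]; rewrite ?mem_below ?mem_above /= !xpair_eqE => yx.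
  by apply: hlt; nia.
by apply: hgt; [exact: mem_grid_ext|nia].
Qed.

Section PL.
Variable R : realFieldType.
Implicit Types f g h : grid -> R.

(** * Rowmotion and promotion *)

(** Rowmotion without a toggling order: lower covers carry old labels, upper covers new ones. *)
Definition row_step f g := forall x,
  g x = seqmax [seq hatf f u | u <- below x] + seqmin [seq hatf g u | u <- above x] - f x.

Lemma rowmotion_step f : row_step f (pl_rowmotion R a b f).
Proof.
move=> x; pose upd (g : grid -> R) y :=
  seqmax [seq hatf g u | u <- below y] + seqmin [seq hatf g u | u <- above y] - g y.
have [h [hx hf hb ha]] := sweep_grid_ext upd f x.
rewrite [LHS]hx /upd hf; congr (seqmax _ + seqmin _ - _); apply/eq_in_map => u.
  exact: hb.
exact: ha.
Qed.

Lemma row_step_inj f g g' : row_step f g -> row_step f g' -> g = g'.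
Proof.
move=> fg fg'; apply: functional_extensionality => x.
have [n] := ubnP (a - x.1 + (b - x.2)); elim: n x => // n IH x hn.
rewrite fg fg'; congr (_ + seqmin _ - _); apply/eq_in_map => -[[[i hi] [j hj]]|//].
by rewrite mem_above /= !xpair_eqE /= => yx; apply: IH => /=; lia.
Qed.

(** Stated for any sequence of labellings, so that it also applies to the one extracted from a
    promotion orbit. *)
Theorem row_step_periodic (F : nat -> grid -> R) :
  (forall t, row_step (F t) (F t.+1)) -> forall t, F (t + (a + b))%N = F t.
Proof.
move=> FE t; apply: functional_extensionality => x0.
wlog -> : F FE t / t = 0%N.
  move=> H; have := H (fun s => F (t + s)%N) _ 0%N erefl.
  by rewrite addn0 add0n; apply => s; rewrite addnS.
(* The extra index [None], of value 1, provides the label of the top. *)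
have [K [V [VT [X0 VX0]]]] :=
  tropicalization_exists (fun u : option grid => if u is Some x then F 0%N x else 1).
pose beta := X0 None.
pose hatK := hatv 1 beta.
pose upd (g : grid -> K) y := (\sum_(u <- below y) hatK g u) *
   (\sum_(u <- above y) (hatK g u)^-1)^-1 * (g y)^-1.
pose X t := iter t (sweep upd (grid_ext a b)) (fun x => X0 (Some x)).
have XE s y : X s.+1 y = (\sum_(u <- below y) hatK (X s) u) *
   (\sum_(u <- above y) (hatK (X s.+1) u)^-1)^-1 * (X s y)^-1.
  have [h [hx hf hb ha]] := sweep_grid_ext upd (X s) y.
  rewrite /X iterS -/(X s) hx /upd hf; congr (_ * _^-1 * _); apply: eq_big_seq => u uy.
    exact: hb.
  by congr (_^-1); apply: ha.
have Vhat (f : grid -> R) (g : grid -> K) u :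
    (forall y, u = inl y -> V (g y) (f y)) -> V (hatK g u) (hatf f u).
  by case: u => [y|[]] fg /=; [exact: fg|exact: (VX0 None)|exact: (trop_one VT)].
(* The inner induction descends from the top, because the new labels of upper covers enter the
   formula. *)
have VX s : forall y : grid, V (X s y) (F s y).
  elim: s => [|s IH] y; first exact: (VX0 (Some y)).
  have [n] := ubnP (a - y.1 + (b - y.2)); elim: n y => // n IHn y hn.
  rewrite XE FE; apply: (trop_mul VT); last exact: (trop_inv VT).
  apply: (trop_mul VT).
    by apply: (trop_sum VT) (below_neq0 y) => u _; apply: Vhat.
  apply: (trop_harmonic VT) (above_neq0 y) => u uy; apply: Vhat => -[[k hk] [l hl]] uE.
  by move: uy; rewrite uE mem_above /= !xpair_eqE /= => uy; apply: IHn => /=; lia.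
clearbody X.
have X_neq0 s y : X s y != 0 by apply: (trop_neq0 VT (VX s y)).
have beta0 : beta != 0 by apply: (trop_neq0 VT (VX0 None)).
have above0 s y : \sum_(u <- above y) (hatK (X s) u)^-1 != 0.
  rewrite -invr_eq0.
  by apply: (trop_neq0 VT); apply: (trop_harmonic VT) (above_neq0 y) => u _; apply: Vhat.
(* As [pos] is injective, the sum has at most one term; empty sums supply the zero labels required
   by [framed]. *)
pose ext (phi : hat -> K) i j := \sum_(u | pos u == (i, j)) phi u.
have extE phi u : ext phi (pos u).1 (pos u).2 = phi u.
  rewrite /ext -surjective_pairing (big_pred1 u) // => v; exact: (inj_eq pos_inj).
have ext0 phi i j : (forall u, pos u != (i, j)) -> ext phi i j = 0.
  by move=> H; rewrite /ext big_pred0 // => u; apply/negbTE.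
have extV phi i j : (ext phi i j)^-1 = ext (fun u => (phi u)^-1) i j.
  have [u /eqP pu|no] := pickP (fun u => pos u == (i, j)).
    by have := extE phi u; have := extE (fun u => (phi u)^-1) u; rewrite pu /= => -> ->.
  by rewrite !ext0 ?invr0 // => u; rewrite no.
have sumE phi (s : seq hat) k l : uniq s -> k != l ->
    (forall u, (u \in s) = (pos u == k) || (pos u == l)) ->
    \sum_(u <- s) phi u = ext phi k.1 k.2 + ext phi l.1 l.2.
  move=> us kl sE; rewrite big_uniq //= (eq_bigl _ _ sE) (bigID (fun u => pos u == k)) /=.
  rewrite /ext -!surjective_pairing; congr (_ + _); apply: eq_bigl => u.
    by case: eqP => //=; rewrite andbF.
  by case: (pos u =P k) => [->|]; rewrite ?(negbTE kl) ?andbT.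
pose x s := ext (hatK (X s)).
have Xx s y : X s y = x s y.1.+1 y.2.+1.
  exact: esym (extE (hatK (X s)) (inl y)).
have x_framed s : framed a b 1 beta (x s).
  split.
  - move=> i j hi hj; have hi1 : (i.-1 < a)%N by lia.
    have hj1 : (j.-1 < b)%N by lia.
    have := Xx s (Ordinal hi1, Ordinal hj1); rewrite /= !prednK; [|lia..].
    by move=> <-.
  - move=> i hi; split; apply: ext0 => -[[[k hk] [l hl]]|[]] //=; rewrite xpair_eqE; lia.
  - move=> j hj; case: eqP => [->|j1]; first exact: (extE _ (inr false)).
    by apply: ext0 => -[[[k hk] [l hl]]|[]] //=; rewrite xpair_eqE; lia.
  - move=> j hj; case: eqP => [->|j1]; first exact: (extE _ (inr true)).
    by apply: ext0 => -[[[k hk] [l hl]]|[]] //=; rewrite xpair_eqE; lia.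
have x_rec s i j : (0 < i <= a)%N -> (0 < j <= b)%N ->
  x s.+1 i j * x s i j * ((x s.+1 i.+1 j)^-1 + (x s.+1 i j.+1)^-1) =
  x s i.-1 j + x s i j.-1.
  case: i => // i; case: j => // j hi hj; pose y : grid := (Ordinal hi, Ordinal hj).
  have := Xx s.+1 y; have := Xx s y; rewrite /= => <- <-.
  have := @sumE (hatK (X s)) _ _ _ (enum_uniq _) _ (mem_below y).
  rewrite /= => <-; last by rewrite xpair_eqE; lia.
  rewrite !extV.
  have := @sumE (fun u => (hatK (X s.+1) u)^-1) _ _ _ (enum_uniq _) _ (mem_above y).
  rewrite /= => <-; last by rewrite xpair_eqE; lia.
  rewrite [X s.+1 y]XE; have := above0 s.+1 y; have := X_neq0 s y.
  move: (X s y) (\sum_(u <- above y) _) => u v u0 v0.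
  by rewrite !mulfVK.
have E : x (0 + (a + b))%N x0.1.+1 x0.2.+1 = x 0%N x0.1.+1 x0.2.+1.
  apply: (birational_periodicity a_gt0 b_gt0 (oner_neq0 _) beta0 x_framed x_rec).
    exact: (ltn_ord x0.1).
  exact: (ltn_ord x0.2).
rewrite -!Xx in E.
by apply: (trop_inj VT) (VX 0%N x0); rewrite -E; apply: VX.
Qed.

Corollary rowmotion_periodic f : iter (a + b) (pl_rowmotion R a b) f = f.
Proof.
have H t : row_step (iter t (pl_rowmotion R a b) f) (iter t.+1 (pl_rowmotion R a b) f).
  exact: rowmotion_step.
exact: (row_step_periodic H 0%N).
Qed.

(** * Promotion and its comparison with rowmotion *)

Lemma belowP x y : inl y \in below x ->
  [/\ y.1.+1 = x.1 :> nat, y.2 = x.2 :> nat & (file a b x < file a b y)%N] \/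
  [/\ y.1 = x.1 :> nat, y.2.+1 = x.2 :> nat & (file a b y < file a b x)%N].
Proof.
rewrite mem_below /= !xpair_eqE /file; case: x y => [[i hi] [j hj]] [[k hk] [l hl]] /=.
by case/orP => /andP[/eqP e1 /eqP e2]; [left|right]; split; lia.
Qed.

Lemma aboveP x y : inl y \in above x ->
  [/\ y.1 = x.1.+1 :> nat, y.2 = x.2 :> nat & (file a b y < file a b x)%N] \/
  [/\ y.1 = x.1 :> nat, y.2 = x.2.+1 :> nat & (file a b x < file a b y)%N].
Proof.
rewrite mem_above /= !xpair_eqE /file; case: x y => [[i hi] [j hj]] [[k hk] [l hl]] /=.
by case/orP => /andP[/eqP e1 /eqP e2]; [left|right]; split; lia.
Qed.

Lemma toggleK x : involutive (toggle (R := R) (grid_le a b) x).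
Proof.
move=> f; apply: functional_extensionality => y; rewrite {1}/toggle.
case: eqVneq => [->|/negbTE yx]; last by rewrite /toggle yx.
rewrite -/(below x) -/(above x).
have Eb : {in below x, hatf (toggle (grid_le a b) x f) =1 hatf f}.
  move=> [z|//] /belowP zx /=; rewrite /toggle; case: eqVneq => // zE.
  by move: zx; rewrite zE ltnn => -[[]|[]].
have Ea : {in above x, hatf (toggle (grid_le a b) x f) =1 hatf f}.
  move=> [z|//] /aboveP zx /=; rewrite /toggle; case: eqVneq => // zE.
  by move: zx; rewrite zE ltnn => -[[]|[]].
have -> := (eq_in_map _ _ _).1 Eb; have -> := (eq_in_map _ _ _).1 Ea.
by rewrite /toggle eqxx -/(below x) -/(above x); ring.
Qed.

(** Files are listed in decreasing order because [foldr] toggles the end of the sequence first. *)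
Definition promotion_order : seq grid :=
  flatten [seq [seq x <- grid_ext a b | file a b x == k] | k <- rev (iota 1 (a + b - 1))].

Lemma promotionE f : pl_promotion R a b f =
  foldr (fun x g => toggle (grid_le a b) x g) f promotion_order.
Proof.
rewrite /pl_promotion /promotion_order.
elim/last_ind: (iota _ _) => //= ks k IH.
by rewrite foldl_rcons IH rev_rcons /= foldr_cat.
Qed.

Lemma promotion_inj : injective (pl_promotion R a b).
Proof.
move=> f g; rewrite !promotionE; elim: promotion_order => //= x s IH H.
by apply: IH; rewrite -[LHS](toggleK x) H toggleK.
Qed.

Lemma promotion_orderP :
  [/\ uniq promotion_order, forall x, x \in promotion_order &
    pairwise (fun y z => a + b - file a b y <= a + b - file a b z)%N promotion_order].
Proof.
have fileP (x : grid) : (1 <= file a b x < a + b)%N.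
  by rewrite /file; have := ltn_ord x.1; have := ltn_ord x.2; lia.
split.
- rewrite /promotion_order.
  have : uniq (rev (iota 1 (a + b - 1))) by rewrite rev_uniq iota_uniq.
  elim: (rev _) => //= k ks IH /andP[kks us]; rewrite cat_uniq IH // andbT.
  rewrite filter_uniq ?uniq_grid_ext //=; apply/hasPn => x /flatten_mapP[k' k'ks].
  rewrite !mem_filter => /andP[/eqP xk' _]; rewrite xk'.
  by case: eqP => // kk; rewrite -kk k'ks in kks.
- move=> x; apply/flatten_mapP; exists (file a b x).
    by rewrite mem_rev mem_iota; have := fileP x; lia.
  by rewrite mem_filter eqxx mem_grid_ext.
- rewrite /promotion_order.
  have : pairwise (fun k l => l < k)%N (rev (iota 1 (a + b - 1))).
    rewrite -sorted_pairwise; last by move=> u v w; lia.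
    by rewrite rev_sorted iota_ltn_sorted.
  elim: (rev _) => //= k ks IH /andP[/allP kks ps]; rewrite pairwise_cat IH // andbT.
  apply/andP; split.
    apply/allrelP => x y; rewrite mem_filter => /andP[/eqP -> _].
    move=> /flatten_mapP[k' /kks k'k]; rewrite mem_filter => /andP[/eqP -> _]; lia.
  have : all (fun x => file a b x == k) [seq x <- grid_ext a b | file a b x == k].
    exact: filter_all.
  elim: [seq x <- grid_ext a b | file a b x == k] => //= x s IHs /andP[/eqP xk sk].
  rewrite IHs // andbT; apply: sub_all sk => y /eqP ->; lia.
Qed.

(** h is the labelling when the file of x is reached. Covers in the rectangle join adjacent files,
    so the two conditions fix the labels of all neighbours of x. *)
Definition pro_step f g := forall x, exists h, [/\
  g x = seqmax [seq hatf h u | u <- below x] + seqmin [seq hatf h u | u <- above x] - f x,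
  forall y, (file a b y < file a b x)%N -> h y = g y &
  forall y, (file a b x < file a b y)%N -> h y = f y].

Lemma promotion_step f : pro_step f (pl_promotion R a b f).
Proof.
move=> x; pose upd (g : grid -> R) y :=
  seqmax [seq hatf g u | u <- below y] + seqmin [seq hatf g u | u <- above y] - g y.
have [us mem ps] := promotion_orderP.
have [h [hx hf hlt hgt]] := sweepP upd f us ps (mem x).
have fileP (y : grid) : (1 <= file a b y < a + b)%N.
  by rewrite /file; have := ltn_ord y.1; have := ltn_ord y.2; lia.
exists h; rewrite promotionE; split.
- by rewrite [LHS]hx /upd hf.
- by move=> y yx; apply: hgt => //; have := fileP x; lia.
- by move=> y yx; apply: hlt; have := fileP y; lia.
Qed.

Lemma pro_step_inj f g g' : pro_step f g -> pro_step f g' -> g = g'.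
Proof.
move=> fg fg'; apply: functional_extensionality => x.
have [n] := ubnP (file a b x); elim: n x => // n IH x hn.
have [h [-> hlt hgt]] := fg x; have [h' [-> hlt' hgt']] := fg' x.
have hE y : (file a b y < file a b x)%N -> h y = h' y.
  by move=> yx; rewrite hlt // hlt' // IH //; lia.
have hE' y : (file a b x < file a b y)%N -> h y = h' y.
  by move=> yx; rewrite hgt // hgt'.
congr (seqmax _ + seqmin _ - _); apply/eq_in_map => -[y|//].
  by case/belowP => -[_ _ yx] /=; [apply: hE'|apply: hE].
by case/aboveP => -[_ _ yx] /=; [apply: hE|apply: hE'].
Qed.

(** On the slice P_t(i,j) = F_{t+j}(i,j), the lower covers (i-1,j), still old, and (i,j-1), already
    new, both show time t+j; the upper covers (i+1,j), new, and (i,j+1), old, both show t+j+1. *)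
Lemma row_step_pro_step (F : nat -> grid -> R) t :
  (forall s, row_step (F s) (F s.+1)) ->
  pro_step (fun x => F (t + x.2)%N x) (fun x => F (t.+1 + x.2)%N x).
Proof.
move=> FE x; exists (fun y => if (file a b y < file a b x)%N
  then F (t.+1 + y.2)%N y else F (t + y.2)%N y); split.
- rewrite addSn FE; congr (seqmax _ + seqmin _ - _); apply/eq_in_map => -[y|//].
    case/belowP => -[_ yx fyx] /=; last by rewrite fyx -yx addSnnS.
    by rewrite ltnNge ltnW //= yx.
  case/aboveP => -[_ yx fyx] /=; first by rewrite fyx -yx.
  by rewrite ltnNge ltnW //= yx addnS.
- by move=> y ->.
- by move=> y yx; rewrite ltnNge ltnW.
Qed.

(** The inverse change of slices, delayed by b-1 to keep all times nonnegative. *)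
Lemma pro_step_row_step (P : nat -> grid -> R) t :
  (forall s, pro_step (P s) (P s.+1)) ->
  row_step (fun x => P (t + (b.-1 - x.2))%N x) (fun x => P (t.+1 + (b.-1 - x.2))%N x).
Proof.
move=> PE x; have [h [hx hlt hgt]] := PE (t + (b.-1 - x.2))%N x.
rewrite addSn hx; congr (seqmax _ + seqmin _ - _); apply/eq_in_map => -[[k l]|//].
  have lb := ltn_ord x.2; case/belowP => -[/= _ yx fyx].
    by rewrite hgt // yx.
  by rewrite hlt //; congr (P _ _); lia.
have lb := ltn_ord l; case/aboveP => -[/= _ yx fyx].
  by rewrite hlt // yx.
by rewrite hgt //; congr (P _ _); lia.
Qed.

Theorem promotion_periodic f : iter (a + b) (pl_promotion R a b) f = f.
Proof.
pose P t := iter t (pl_promotion R a b) f.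
have PE s : pro_step (P s) (P s.+1) by exact: promotion_step.
(* The rowmotion orbit attached to P starts only at time b - 1, so the first values are recovered
   from the injectivity of promotion. *)
have E s : (b <= s)%N -> P (s + (a + b))%N = P s.
  move=> bs; apply: functional_extensionality => x.
  pose F t (y : grid) := P (t + (b.-1 - y.2))%N y.
  have FE t : row_step (F t) (F t.+1) by exact: pro_step_row_step.
  have := congr1 (fun g => g x) (row_step_periodic FE (s - (b.-1 - x.2))).
  rewrite /F; set u := (_ + _ + _)%N; set v := (_ + _)%N.
  have -> : u = (s + (a + b))%N by rewrite /u; lia.
  by have -> : v = s by rewrite /v; lia.
have iter_inj n : injective (iter n (pl_promotion R a b)).
  by elim: n => //= n IH g h /promotion_inj; apply: IH.
by have := E b (leqnn b); rewrite /P iterD => /iter_inj.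
Qed.

(** * The orbit of the constant labelling 1 and minimality of the period *)

Definition level k : grid -> R := fun x => ((k <= x.1 + x.2)%N)%:R.

Lemma seqmax_const (U : eqType) (F : U -> R) s c : (0 < size s)%N ->
  {in s, forall u, F u = c} -> seqmax [seq F u | u <- s] = c.
Proof.
move=> s0 Fc; have -> : [seq F u | u <- s] = [seq c | u <- s] by apply/eq_in_map.
case: s s0 {Fc} => // u s _; elim: s u => [|v s IH] u; first by rewrite /seqmax /= maxxx.
by rewrite seqmax_cons2 (IH v) maxxx.
Qed.

(** The minimum over upper covers equals the old label of x and cancels it, leaving the maximum over
    lower covers. The bound on k makes the label 1 of the top fit. *)
Lemma level_row_step k : (k < (a + b).-1)%N -> row_step (level k) (level k.+1).
Proof.
move=> kn x.
rewrite (seqmax_const (c := (k < x.1 + x.2)%:R) (below_neq0 x)); last first.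
  move=> [[i j] /belowP yx|[] /=].
  - by congr ((nat_of_bool _)%:R); case: yx => -[/= e1 e2 _]; lia.
  - by rewrite mem_below /= !xpair_eqE; have := ltn_ord x.1; have := ltn_ord x.2; lia.
  - by rewrite mem_below /= !xpair_eqE => H; have -> : (k < x.1 + x.2)%N = false by lia.
rewrite seqmin_opp -map_comp (seqmax_const (c := - (k <= x.1 + x.2)%:R) (above_neq0 x)).
  by rewrite /level; ring.
move=> [[i j] /aboveP yx|[] /=].
- by rewrite /= /level; congr (- (nat_of_bool _)%:R); case: yx => -[/= e1 e2 _]; lia.
- rewrite mem_above /= !xpair_eqE => H; have -> : (k <= x.1 + x.2)%N = true by lia.
  by [].
- by rewrite mem_above /= !xpair_eqE; lia.
Qed.

Lemma iter_rowmotion_level m : (m <= (a + b).-1)%N ->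
  iter m (pl_rowmotion R a b) (level 0) = level m.
Proof.
elim: m => [//|m IH] mn; rewrite iterS IH; last exact: ltnW.
exact: row_step_inj (@rowmotion_step _) (level_row_step mn).
Qed.

Lemma level0_polytope : in_order_polytope (grid_le a b) (level 0).
Proof. by split=> [x|x y _]; rewrite /level !leq0n ?ler01 ?lexx. Qed.

Lemma iter_promotion_level m (x : grid) : (m + x.2 <= (a + b).-1)%N ->
  iter m (pl_promotion R a b) (level 0) x = level (m + x.2) x.
Proof.
pose F t := iter t (pl_rowmotion R a b) (level 0).
have FE t : row_step (F t) (F t.+1) by exact: rowmotion_step.
move=> mx; rewrite -(iter_rowmotion_level mx) -/(F (m + x.2)%N).
(* Both orbits start alike: at time 0 the slice shows [level] j at (i,j), which is 1 since j <= i +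
   j. *)
elim: m {mx} x => [|m IH] x /=.
  rewrite /F iter_rowmotion_level; last by have := ltn_ord x.2; lia.
  by rewrite /level leq0n leq_addl.
have -> : iter m (pl_promotion R a b) (level 0) = fun x => F (m + x.2)%N x.
  exact: functional_extensionality.
by rewrite (pro_step_inj (@promotion_step _) (row_step_pro_step m FE)).
Qed.
End PL.
End Grid.

Theorem theorem1 (R : realFieldType) (a b : nat) (ha : (0 < a)%N) (hb : (0 < b)%N) :
  ((forall f : grid a b -> R, in_order_polytope (grid_le a b) f ->
      iter (a + b) (pl_rowmotion R a b) f = f)
   /\ (forall m : nat, (0 < m < a + b)%N ->
      exists f : grid a b -> R, in_order_polytope (grid_le a b) f /\
        iter m (pl_rowmotion R a b) f <> f))
  /\
  ((forall f : grid a b -> R, in_order_polytope (grid_le a b) f ->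
      iter (a + b) (pl_promotion R a b) f = f)
   /\ (forall m : nat, (0 < m < a + b)%N ->
      exists f : grid a b -> R, in_order_polytope (grid_le a b) f /\
        iter m (pl_promotion R a b) f <> f)).
Proof.
(* The minimal element has label 1 at first and 0 at times 1 to a+b-1. Its 0-based column is 0, so
   promotion and rowmotion show the same labels there. *)
have level_neq m : (0 < m)%N ->
    level R m (Ordinal ha, Ordinal hb) <> level R 0 (Ordinal ha, Ordinal hb).
  by rewrite /level /= leqn0 => /lt0n_neq0/negbTE -> /eqP; rewrite eq_sym oner_eq0.
split; split => [f _|m mn]; [exact: rowmotion_periodic| |exact: promotion_periodic|].
  exists (level R 0); split; first exact: level0_polytope.
  rewrite iter_rowmotion_level //; last lia.
  move/(congr1 (fun g => g (Ordinal ha, Ordinal hb))).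
  by apply: level_neq; lia.
exists (level R 0); split; first exact: level0_polytope.
move/(congr1 (fun g => g (Ordinal ha, Ordinal hb))).
rewrite iter_promotion_level //= addn0; last lia.
by apply: level_neq; lia.
Qed.
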